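(* Let $K$ be a field and let $A$ be a special multiserial $K$-algebra. Then every finitely generated $A$-module is a multiserial module.
   Context: Modules are right modules unless stated otherwise. A finite dimensional $K$-algebra $A$ is special multiserial if $A$ is Morita equivalent to a quotient $KQ/I$ of a path algebra $KQ$ of a (finite) quiver $Q$ by an admissible ideal $I$ such that the following condition (M) holds: for every arrow $a$ in $Q$ there is at most one arrow $b$ in $Q$ such that $ab\notin I$ and at most one arrow $c$ in $Q$ such that $ca\notin I$. Here $ab$ denotes the path consisting of $a$ followed by $b$ (and $ab=0$ in $KQ$ if the end vertex of $a$ is not the start vertex of $b$). A (left or right) $A$-module $M$ is multiserial if $\operatorname{rad}(M)$ can be written as a sum of uniserial modules $U_1,\dots,U_l$ such that, if $i\neq j$, then $U_i\cap U_j$ is either $(0)$ or a simple module. A module is uniserial if its submodules are totally ordered by inclusion (the zero module is regarded as uniserial). *)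

(* Defs.v *)
From HB Require Import structures.
From mathcomp Require Import all_boot all_algebra all_field.
From mathcomp Require Import finmap.
From mathcomp Require Import boolp classical_sets.
From mathcomp Require Import xfinmap monalg.

Set Implicit Arguments.
Unset Strict Implicit.
Unset Printing Implicit Defensive.

Import GRing.Theory.
Local Open Scope classical_set_scope.
Local Open Scope ring_scope.

Record quiver := Quiver {
  vertex : finType;
  arrow : finType;
  source : arrow -> vertex;
  target : arrow -> vertex }.

Section Paths.
Variable Q : quiver.

Fixpoint walk (v : vertex Q) (w : seq (arrow Q)) : bool :=
  if w is a :: w' then (source a == v) && walk (target a) w' else true.

(* A path is its start vertex together with its consecutive arrows, read from
   left to right; the start vertex tells the trivial paths e_v apart. *)
Definition qpath := {p : vertex Q * seq (arrow Q) | walk p.1 p.2}.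

Definition pstart (p : qpath) : vertex Q := (val p).1.
Definition parrows (p : qpath) : seq (arrow Q) := (val p).2.
Definition pend (p : qpath) : vertex Q :=
  last (pstart p) [seq target a | a <- parrows p].

Definition trivial_path (v : vertex Q) : qpath := exist _ (v, [::]) isT.

Lemma arrow_path_subproof (a : arrow Q) : walk (source a) [:: a].
Proof. by rewrite /= eqxx. Qed.

Definition arrow_path (a : arrow Q) : qpath :=
  exist _ (source a, [:: a]) (arrow_path_subproof a).

Lemma walk_cat v w1 w2 :
  walk v (w1 ++ w2) = walk v w1 && walk (last v [seq target a | a <- w1]) w2.
Proof. by elim: w1 v => //= a w IHw v; rewrite IHw andbA. Qed.

(* pcat p q is p followed by q, and None if they are not composable.
   When pend p = pstart q the concatenated walk is valid, so that insub
   returns Some. *)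
Definition pcat (p q : qpath) : option qpath :=
  if pend p == pstart q then insub (pstart p, parrows p ++ parrows q) : option qpath
  else None.

Lemma pcatP p q r : pcat p q = Some r <->
  pend p = pstart q /\ val r = (pstart p, parrows p ++ parrows q).
Proof.
rewrite /pcat; case: eqP => [e|ne]; last by split=> // -[].
have w : walk (pstart p) (parrows p ++ parrows q).
  by rewrite walk_cat -/(pend p) e (valP p) (valP q).
rewrite insubT; split=> [[<-]|[_ e']]; first by split.
by congr Some; apply: val_inj.
Qed.

Lemma pcat_None p q : pcat p q = None <-> pend p <> pstart q.
Proof.
split=> [n e|/eqP/negPf ne]; last by rewrite /pcat ne.
have w : walk (pstart p) (parrows p ++ parrows q).
  by rewrite walk_cat -/(pend p) e (valP p) (valP q).
by move: n; rewrite /pcat e eqxx insubT.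
Qed.

Lemma pcat_start p q r : pcat p q = Some r -> pstart r = pstart p.
Proof. by case/pcatP=> _; rewrite /pstart => ->. Qed.

Lemma pcat_end p q r : pcat p q = Some r -> pend r = pend q.
Proof.
case/pcatP=> e1 e2; rewrite /pend {1}/pstart {1}/parrows e2 /=.
by rewrite map_cat last_cat -/(pend p) e1.
Qed.

Lemma pcatA p q r :
  obind (pcat p) (pcat q r) = obind (pcat^~ r) (pcat p q).
Proof.
case eqr: (pcat q r) => [s|]; case epq: (pcat p q) => [t|] //=.
- case ets: (pcat p s) => [u|].
    apply/esym/pcatP; rewrite (pcat_end epq).
    case/pcatP: eqr => -> es; case/pcatP: epq => _ et; case/pcatP: ets => _ ->.
    by rewrite /pstart /parrows es et /= catA.
  move/pcat_None: ets; rewrite (pcat_start eqr).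
  by case/pcatP: epq => ->.
- by apply/pcat_None; rewrite (pcat_start eqr); apply/pcat_None.
- by apply/esym/pcat_None; rewrite (pcat_end epq); apply/pcat_None.
Qed.

Lemma pcat_trivl v p :
  pcat (trivial_path v) p = if v == pstart p then Some p else None.
Proof.
case: eqP => e; last exact/pcat_None.
by apply/pcatP; split=> //; case: p e => -[u w] wP /= ->.
Qed.

Lemma pcat_trivr v p :
  pcat p (trivial_path v) = if v == pend p then Some p else None.
Proof.
case: eqP => e; last by apply/pcat_None => /esym.
by apply/pcatP; split=> //; rewrite cats0; case: p e => -[u w] wP.
Qed.

End Paths.

(* {malg K[P]} is the free K-module on P: the K-vector space with basis the
   paths of Q. *)
Definition path_alg (K : fieldType) (Q : quiver) := {malg K[qpath Q]}.

HB.instance Definition _ (K : fieldType) (Q : quiver) :=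
  GRing.Zmodule.on (path_alg K Q).

(* The operations of the path algebra are locked to keep failing
   unification problems from unfolding down to finitely supported functions. *)
HB.lock Definition path_scale (K : fieldType) (Q : quiver)
  (c : K) (x : path_alg K Q) : path_alg K Q := c *: (x : {malg K[qpath Q]}).

Section PathModule.
Variables (K : fieldType) (Q : quiver).
Local Notation path_scale := (@path_scale K Q).

Lemma path_scaleA a b x : path_scale a (path_scale b x) = path_scale (a * b) x.
Proof. by rewrite unlock; exact: scalerA. Qed.

Lemma path_scale1 : left_id 1 path_scale.
Proof. by move=> x; rewrite unlock; exact: scale1r. Qed.

Lemma path_scaleDr : right_distributive path_scale +%R.
Proof. by move=> a x y; rewrite unlock; exact: scalerDr. Qed.

Lemma path_scaleDl x : {morph path_scale^~ x : a b / a + b}.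
Proof. by move=> a b; rewrite unlock; exact: scalerDl. Qed.

HB.instance Definition _ := GRing.Zmodule_isLmodule.Build K (path_alg K Q)
  path_scaleA path_scale1 path_scaleDr path_scaleDl.

Lemma mcoeff_scale (c : K) (x : path_alg K Q) p : (c *: x)@_p = c * x@_p.
Proof. by rewrite /GRing.scale /= unlock; exact: mcoeffZ. Qed.

Lemma msupp_scale (c : K) (x : path_alg K Q) :
  (msupp (c *: x) `<=` msupp x)%fset.
Proof. by rewrite /GRing.scale /= unlock; exact: msuppZ_le. Qed.

End PathModule.

HB.lock Definition path_elt (K : fieldType) (Q : quiver) (p : qpath Q) :
  path_alg K Q := << p >>.

Definition opath (K : fieldType) (Q : quiver) (o : option (qpath Q)) :
  path_alg K Q := oapp (@path_elt K Q) 0 o.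

HB.lock Definition path_mul (K : fieldType) (Q : quiver)
    (x y : path_alg K Q) : path_alg K Q :=
  \sum_(p <- msupp x) \sum_(q <- msupp y) (x@_p * y@_q) *: opath K (pcat p q).

Section PathAlgebra.
Variables (K : fieldType) (Q : quiver).
Implicit Types (x y z : path_alg K Q) (p q r : qpath Q).

Local Notation path_elt := (@path_elt K Q).
Local Notation opath := (@opath K Q).
Local Notation path_mul := (@path_mul K Q).

Definition path_one : path_alg K Q :=
  \sum_(v : vertex Q) path_elt (trivial_path v).

Lemma path_mulw (d1 d2 : {fset qpath Q}) x y :
  (msupp x `<=` d1)%fset -> (msupp y `<=` d2)%fset ->
  path_mul x y =
    \sum_(p <- d1) \sum_(q <- d2) (x@_p * y@_q) *: opath (pcat p q).
Proof.
move=> le1 le2; rewrite unlock (big_fset_incl _ le1) /=.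
  apply/eq_bigr=> p _; apply/big_fset_incl => // q _ /mcoeff_outdom ->.
  by rewrite mulr0 scale0r.
move=> p _ /mcoeff_outdom xp.
by rewrite big1 // => q _; rewrite xp mul0r scale0r.
Qed.

Lemma path_mulDl : left_distributive path_mul +%R.
Proof.
move=> x y z.
rewrite (path_mulw (msuppD_le x y) (fsubset_refl _)).
rewrite (path_mulw (fsubsetUl _ (msupp y)) (fsubset_refl (msupp z))).
rewrite (path_mulw (fsubsetUr (msupp x) _) (fsubset_refl (msupp z))).
rewrite -big_split /=; apply/eq_bigr=> p _.
rewrite -big_split /=; apply/eq_bigr=> q _.
by rewrite mcoeffD mulrDl scalerDl.
Qed.

Lemma path_mulDr : right_distributive path_mul +%R.
Proof.
move=> z x y.
rewrite (path_mulw (fsubset_refl _) (msuppD_le x y)).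
rewrite (path_mulw (fsubset_refl (msupp z)) (fsubsetUl _ (msupp y))).
rewrite (path_mulw (fsubset_refl (msupp z)) (fsubsetUr (msupp x) _)).
rewrite -big_split /=; apply/eq_bigr=> p _.
rewrite -big_split /=; apply/eq_bigr=> q _.
by rewrite mcoeffD mulrDr scalerDl.
Qed.

Lemma path_mul0l y : path_mul 0 y = 0.
Proof. by rewrite unlock msupp0 big_seq_fset0. Qed.

Lemma path_mul0r x : path_mul x 0 = 0.
Proof. by rewrite unlock big1 // => p _; rewrite msupp0 big_seq_fset0. Qed.

Lemma path_mulZl c x y : path_mul (c *: x) y = c *: path_mul x y.
Proof.
rewrite (path_mulw (msupp_scale c x) (fsubset_refl _)).
rewrite [in RHS]unlock scaler_sumr.
apply: eq_bigr => p _; rewrite scaler_sumr; apply: eq_bigr => q _.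
by rewrite mcoeff_scale scalerA mulrA.
Qed.

Lemma path_mulZr c x y : path_mul x (c *: y) = c *: path_mul x y.
Proof.
rewrite (path_mulw (fsubset_refl _) (msupp_scale c y)).
rewrite [in RHS]unlock scaler_sumr.
apply: eq_bigr => p _; rewrite scaler_sumr; apply: eq_bigr => q _.
by rewrite mcoeff_scale scalerA mulrCA.
Qed.

Lemma path_mulUU p q :
  path_mul (path_elt p) (path_elt q) = opath (pcat p q).
Proof.
rewrite path_elt.unlock (path_mulw (@msuppU_le _ K p 1) (@msuppU_le _ K q 1)).
by rewrite big_seq_fset1 big_seq_fset1 !mcoeffUU mulr1 scale1r.
Qed.

Lemma path_algE x : x = \sum_(p <- msupp x) x@_p *: path_elt p.
Proof.
rewrite path_elt.unlock {1}[x]monalgE; apply: eq_bigr => p _.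
by apply/malgP => q; rewrite [RHS]mcoeff_scale [in RHS]mcoeffU mcoeffU mulrnAr mulr1.
Qed.

Lemma path_alg_ind (P : path_alg K Q -> Prop) :
  P 0 -> (forall c p x, P x -> P (c *: path_elt p + x)) -> forall x, P x.
Proof.
move=> P0 PD x; rewrite [x]path_algE.
elim: (enum_fset (msupp x)) => [|p s IHs]; first by rewrite big_nil.
by rewrite big_cons; exact: PD.
Qed.

Lemma path_mulA : associative path_mul.
Proof.
move=> x y z.
elim/path_alg_ind: x => [|c p x IHx]; first by rewrite !path_mul0l.
rewrite !path_mulDl {}IHx; congr (_ + _); rewrite !path_mulZl; congr (_ *: _).
elim/path_alg_ind: y => [|d q y IHy].
  by rewrite path_mul0l !path_mul0r path_mul0l.
rewrite path_mulDl !path_mulDr path_mulDl {}IHy; congr (_ + _).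
rewrite path_mulZl !path_mulZr path_mulZl; congr (_ *: _).
elim/path_alg_ind: z => [|e r z IHz]; first by rewrite !path_mul0r.
rewrite !path_mulDr {}IHz; congr (_ + _); rewrite !path_mulZr; congr (_ *: _).
rewrite !path_mulUU; have := pcatA p q r.
case: (pcat q r) => [s|] /=; case: (pcat p q) => [t|] /= e'.
- by rewrite !path_mulUU e'.
- by rewrite path_mulUU path_mul0l e'.
- by rewrite path_mulUU path_mul0r -e'.
- by rewrite path_mul0l path_mul0r.
Qed.

Lemma path_one_mulU p : path_mul path_one (path_elt p) = path_elt p.
Proof.
rewrite /path_one (big_morph (path_mul^~ _) (fun _ _ => path_mulDl _ _ _)
  (path_mul0l _)) (bigD1 (pstart p)) //= big1 ?addr0.
  by rewrite path_mulUU pcat_trivl eqxx.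
by move=> v /negPf nv; rewrite path_mulUU pcat_trivl nv.
Qed.

Lemma path_mulU_one p : path_mul (path_elt p) path_one = path_elt p.
Proof.
rewrite /path_one (big_morph (path_mul _) (fun _ _ => path_mulDr _ _ _)
  (path_mul0r _)) (bigD1 (pend p)) //= big1 ?addr0.
  by rewrite path_mulUU pcat_trivr eqxx.
by move=> v /negPf nv; rewrite path_mulUU pcat_trivr nv.
Qed.

Lemma path_mul1l : left_id path_one path_mul.
Proof.
elim/path_alg_ind => [|c p x IHx]; first exact: path_mul0r.
by rewrite path_mulDr path_mulZr path_one_mulU IHx.
Qed.

Lemma path_mul1r : right_id path_one path_mul.
Proof.
elim/path_alg_ind => [|c p x IHx]; first exact: path_mul0l.
by rewrite path_mulDl path_mulZl path_mulU_one IHx.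
Qed.

HB.instance Definition _ := GRing.Zmodule_isPzRing.Build (path_alg K Q)
  path_mulA path_mul1l path_mul1r path_mulDl path_mulDr.

Lemma path_eltM p q :
  (path_elt p * path_elt q : path_alg K Q) = opath (pcat p q).
Proof. exact: path_mulUU. Qed.

Lemma path_scaleAl (c : K) x y : c *: (x * y) = c *: x * y.
Proof. by rewrite [RHS]path_mulZl. Qed.

Lemma path_scaleAr (c : K) x y : c *: (x * y) = x * (c *: y).
Proof. by rewrite [RHS]path_mulZr. Qed.

Definition arrow_elt (a : arrow Q) : path_alg K Q := path_elt (arrow_path a).

End PathAlgebra.

Arguments arrow_elt K {Q} a.

(* Two-sided ideals; in the unital algebra path_alg K Q these are K-subspaces,
   since c *: x = (c *: 1) * x. *)
Record ideal (R : pzRingType) := Ideal {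
  ideal_set :> R -> Prop;
  ideal_0 : ideal_set 0;
  ideal_B : forall x y, ideal_set x -> ideal_set y -> ideal_set (x - y);
  ideal_Ml : forall x y, ideal_set y -> ideal_set (x * y);
  ideal_Mr : forall x y, ideal_set x -> ideal_set (x * y) }.

Definition ideal_gen (R : pzRingType) (S : set R) : set R :=
  [set x | forall I : ideal R, S `<=` I -> I x].

Definition ideal_mul (R : pzRingType) (I J : set R) : set R :=
  ideal_gen [set z | exists x y, [/\ I x, J y & z = x * y]].

Definition ideal_exp (R : pzRingType) (I : set R) (n : nat) : set R :=
  iter n (ideal_mul I) setT.

Section QuotientRing.
Variables (R : pzRingType) (I : ideal R).

Definition ideal_pred : R -> bool := fun x => `[< I x >].

Lemma ideal_pred_zmod : zmod_closed ideal_pred.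
Proof.
split=> [|x y]; rewrite /in_mem /= /ideal_pred.
  by apply/asboolP; exact: ideal_0.
by move=> /asboolP Ix /asboolP Iy; apply/asboolP; exact: ideal_B.
Qed.

HB.instance Definition _ := GRing.isZmodClosed.Build R ideal_pred
  ideal_pred_zmod.

Definition ideal_zmod : zmodClosed R := GRing.ZmodClosed.clone R ideal_pred _.

Definition quot_ring : Type := Quotient.quot ideal_zmod.

HB.instance Definition _ := GRing.Zmodule.on quot_ring.

Definition quot_proj (x : R) : quot_ring := (\pi_quot_ring x)%qT.

Lemma quot_projP x y : quot_proj x = quot_proj y <-> I (x - y).
Proof.
split=> [/eqP|Ixy].
  by rewrite /quot_proj -Quotient.idealrBE => /asboolP.
by apply/eqP; rewrite /quot_proj -Quotient.idealrBE; apply/asboolP.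
Qed.

Lemma quot_projK (u : quot_ring) : quot_proj (repr u) = u.
Proof. exact: reprK. Qed.

Lemma quot_projD x y : quot_proj (x + y) = quot_proj x + quot_proj y.
Proof. exact: raddfD. Qed.

Definition quot_one : quot_ring := quot_proj 1.
Definition quot_mul (u v : quot_ring) : quot_ring :=
  quot_proj (repr u * repr v).

Lemma quot_projM x y : quot_mul (quot_proj x) (quot_proj y) = quot_proj (x * y).
Proof.
apply/quot_projP; set x' := repr _; set y' := repr _.
have Ix : I (x' - x) by apply/quot_projP; exact: quot_projK.
have Iy : I (y' - y) by apply/quot_projP; exact: quot_projK.
have -> : x' * y' - x * y = (x' - x) * y' - x * (y - y').
  by rewrite mulrBl mulrBr opprB addrA subrK.
apply: ideal_B; first exact: ideal_Mr.
apply: ideal_Ml; rewrite -opprB -sub0r; apply: ideal_B => //; exact: ideal_0.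
Qed.

Lemma quot_mulA : associative quot_mul.
Proof.
move=> u v w; rewrite -[u]quot_projK -[v]quot_projK -[w]quot_projK.
by rewrite !quot_projM mulrA.
Qed.

Lemma quot_mul1l : left_id quot_one quot_mul.
Proof. by move=> u; rewrite -[u]quot_projK quot_projM mul1r. Qed.

Lemma quot_mul1r : right_id quot_one quot_mul.
Proof. by move=> u; rewrite -[u]quot_projK quot_projM mulr1. Qed.

Lemma quot_mulDl : left_distributive quot_mul +%R.
Proof.
move=> u v w; rewrite -[u]quot_projK -[v]quot_projK -[w]quot_projK.
by rewrite -quot_projD !quot_projM mulrDl quot_projD.
Qed.

Lemma quot_mulDr : right_distributive quot_mul +%R.
Proof.
move=> u v w; rewrite -[u]quot_projK -[v]quot_projK -[w]quot_projK.
by rewrite -quot_projD !quot_projM mulrDr quot_projD.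
Qed.

HB.instance Definition _ := GRing.Zmodule_isPzRing.Build quot_ring
  quot_mulA quot_mul1l quot_mul1r quot_mulDl quot_mulDr.

End QuotientRing.

Section Modules.
Variables (R : pzRingType) (M : lmodType R).
Implicit Types U V : set M.

Definition submodule U : Prop :=
  U 0 /\ forall (a : R) x y, U x -> U y -> U (a *: x + y).

Definition maximal_submodule U : Prop :=
  [/\ submodule U, U <> setT &
      forall V, submodule V -> U `<=` V -> V = U \/ V = setT].

Definition simple_submodule U : Prop :=
  [/\ submodule U, U <> [set 0] &
      forall V, submodule V -> V `<=` U -> V = [set 0] \/ V = U].

Definition uniserial_submodule U : Prop :=
  submodule U /\
  forall V W, submodule V -> submodule W -> V `<=` U -> W `<=` U ->
    V `<=` W \/ W `<=` V.

(* Equal to M when M has no maximal submodule. *)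
Definition mod_rad : set M := \bigcap_(U in maximal_submodule) U.

Definition submod_sum (l : nat) (U : 'I_l -> set M) : set M :=
  [set x | exists2 u : 'I_l -> M, (forall i, U i (u i)) & x = \sum_(i < l) u i].

Definition multiserial : Prop :=
  exists (l : nat) (U : 'I_l -> set M),
    [/\ forall i, uniserial_submodule (U i),
        mod_rad = submod_sum U &
        forall i j, i != j ->
          U i `&` U j = [set 0] \/ simple_submodule (U i `&` U j)].

Definition finitely_generated : Prop :=
  exists (n : nat) (g : 'I_n -> M),
    forall x, exists c : 'I_n -> R, x = \sum_(i < n) c i *: g i.

End Modules.

Arguments mod_rad {R} M.
Arguments multiserial {R} M.
Arguments finitely_generated {R} M.

(* Functors between module categories.  Morphisms are linear maps up to
   pointwise equality. *)
Record mod_functor (R S : pzRingType) := ModFunctor {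
  fobj :> lmodType R -> lmodType S;
  fmap : forall M N : lmodType R, {linear M -> N} -> {linear fobj M -> fobj N};
  fmap_ext : forall (M N : lmodType R) (f g : {linear M -> N}),
    f =1 g -> fmap f =1 fmap g;
  fmap_id : forall M : lmodType R,
    fmap (idfun : {linear M -> M}) =1 idfun;
  fmap_comp : forall (M N P : lmodType R)
      (f : {linear M -> N}) (g : {linear N -> P}),
    fmap (g \o f : {linear M -> P}) =1 fmap g \o fmap f }.

Definition id_functor (R : pzRingType) : mod_functor R R.
Proof. by apply: (@ModFunctor R R id (fun _ _ f => f)). Defined.

Definition comp_functor (R S T : pzRingType)
  (G : mod_functor S T) (F : mod_functor R S) : mod_functor R T.
Proof.
apply: (@ModFunctor R T (fun M => G (F M)) (fun _ _ f => fmap G (fmap F f))).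
- by move=> M N f g fg; apply: fmap_ext; apply: fmap_ext.
- move=> M x; rewrite -[RHS](@fmap_id _ _ G); apply: fmap_ext; exact: fmap_id.
- move=> M N P f g x; rewrite -[RHS](@fmap_comp _ _ G _ _ _ (fmap F f)).
  apply: fmap_ext; exact: fmap_comp.
Defined.

Definition nat_isomorphic (R S : pzRingType) (F G : mod_functor R S) : Prop :=
  exists (phi : forall M : lmodType R, {linear F M -> G M})
         (psi : forall M : lmodType R, {linear G M -> F M}),
    [/\ forall M, cancel (phi M) (psi M),
        forall M, cancel (psi M) (phi M) &
        forall (M N : lmodType R) (f : {linear M -> N}),
          phi N \o fmap F f =1 fmap G f \o phi M].

(* Right modules over R are (left) modules over the converse ring R^c.
   An equivalence of module categories is automatically additive, so additivity
   of F and G is not required separately; neither is K-linearity when R and S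
   are K-algebras. *)
Definition morita_equivalent (R S : pzRingType) : Prop :=
  exists (F : mod_functor R^c S^c) (G : mod_functor S^c R^c),
    nat_isomorphic (comp_functor G F) (id_functor R^c) /\
    nat_isomorphic (comp_functor F G) (id_functor S^c).

Section SpecialMultiserial.
Variables (K : fieldType) (Q : quiver).

Definition arrow_ideal : set (path_alg K Q) := ideal_gen (range (arrow_elt K)).

Definition admissible (I : ideal (path_alg K Q)) : Prop :=
  I `<=` ideal_exp arrow_ideal 2 /\
  exists2 n : nat, (2 <= n)%N & ideal_exp arrow_ideal n `<=` I.

(* arrow_elt a * arrow_elt b is the path a followed by b, or 0 (hence in I)
   when the target of a is not the source of b. *)
Definition condition_M (I : ideal (path_alg K Q)) : Prop :=
  forall a : arrow Q,
    (forall b b' : arrow Q,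
       ~ I (arrow_elt K a * arrow_elt K b) ->
       ~ I (arrow_elt K a * arrow_elt K b') -> b = b') /\
    (forall c c' : arrow Q,
       ~ I (arrow_elt K c * arrow_elt K a) ->
       ~ I (arrow_elt K c' * arrow_elt K a) -> c = c').

End SpecialMultiserial.

(* falgType K is the type of finite dimensional K-algebras with 1 <> 0. *)
Definition special_multiserial (K : fieldType) (A : falgType K) : Prop :=
  exists (Q : quiver) (I : ideal (path_alg K Q)),
    [/\ admissible I, condition_M I & morita_equivalent A (quot_ring I)].

(* Main.v *)
Require Import Defs.
From HB Require Import structures.
From mathcomp Require Import all_boot all_algebra all_field.
From mathcomp Require Import boolp classical_sets.

(* Through an equivalence of module categories the submodule lattices of M and
   of its image N are isomorphic, and both hypothesis and conclusion of the
   theorem are lattice properties; so let A = KQ/I.  Condition (M) says that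
   every arrow a starts at most one path along which products are nonzero, so
   that x a A is uniserial for every element x, and rad N is a finite sum of
   such modules.  Choose a sum of minimal total length.  If two summands x a A
   and y b A met in a module that is neither zero nor simple, condition (M)
   applied backwards along the two paths would write a generator of the
   intersection as (x a) p and, up to a scalar c and deeper terms, (y' a) p with
   y' a in y b A; replacing x by x - c y' would then give a shorter sum. *)

Set Implicit Arguments.
Unset Strict Implicit.
Unset Printing Implicit Defensive.

Import GRing.Theory.
Local Open Scope classical_set_scope.
Local Open Scope ring_scope.

(** * Submodule lattices *)

Section SubmoduleTheory.
Variables (R : pzRingType) (M : lmodType R).
Implicit Types U V W : set M.

Lemma submodule0 U : submodule U -> U 0.
Proof. by case. Qed.

Lemma submoduleD U x y : submodule U -> U x -> U y -> U (x + y).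
Proof. by case=> _ h Ux Uy; rewrite -[x]scale1r; exact: h. Qed.

Lemma submoduleZ U a x : submodule U -> U x -> U (a *: x).
Proof. by case=> h0 h Ux; rewrite -[_ *: _]addr0; exact: h. Qed.

Lemma submoduleB U x y : submodule U -> U x -> U y -> U (x - y).
Proof.
by move=> sU Ux Uy; rewrite -scaleN1r; apply: submoduleD => //; exact: submoduleZ.
Qed.

Lemma submodule_sum U (J : Type) (r : seq J) (P : pred J) (f : J -> M) :
  submodule U -> (forall i, P i -> U (f i)) -> U (\sum_(i <- r | P i) f i).
Proof.
move=> sU Uf; apply: (big_ind U) => //; first exact: submodule0.
by move=> x y; exact: submoduleD.
Qed.

Lemma submodule_setT : submodule [set: M].
Proof. by []. Qed.

Lemma submodule_zero : submodule ([set 0] : set M).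
Proof. by split=> // a x y /= -> ->; rewrite scaler0 addr0. Qed.

Lemma submoduleI U V : submodule U -> submodule V -> submodule (U `&` V).
Proof.
move=> sU sV; split; first by split; exact: submodule0.
by move=> a x y [Ux Vx] [Uy Vy]; split; [apply: sU.2|apply: sV.2].
Qed.

Lemma submodule_bigcap (J : Type) (D : set J) (F : J -> set M) :
  (forall j, D j -> submodule (F j)) -> submodule (\bigcap_(j in D) F j).
Proof.
move=> sF; split=> [j Dj|a x y Fx Fy j Dj]; first exact: submodule0 (sF j Dj).
by apply: (sF j Dj).2; [exact: Fx|exact: Fy].
Qed.

Lemma submodule_mod_rad : submodule (mod_rad M).
Proof. by apply: submodule_bigcap => U []. Qed.

Lemma submodule_submod_sum l (U : 'I_l -> set M) :
  (forall i, submodule (U i)) -> submodule (submod_sum U).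
Proof.
move=> sU; split.
  by exists (fun=> 0) => [i|]; [exact: submodule0|rewrite big1].
move=> a x y [u Uu ->] [v Uv ->]; exists (fun i => a *: u i + v i) => [i|].
  exact: (sU i).2.
by rewrite scaler_sumr big_split.
Qed.

Lemma submod_sum_ge l (U : 'I_l -> set M) i :
  (forall i, submodule (U i)) -> U i `<=` submod_sum U.
Proof.
move=> sU x Ux; exists (fun j => if j == i then x else 0) => [j|].
  by case: eqP => [->//|_]; exact: submodule0.
by rewrite -big_mkcond big_pred1_eq.
Qed.

Lemma submod_sum_le l (U : 'I_l -> set M) V :
  submodule V -> (forall i, U i `<=` V) -> submod_sum U `<=` V.
Proof.
by move=> sV UV x [u Uu ->]; apply: submodule_sum => // i _; exact/UV/Uu.
Qed.

Definition submod_gen (s : seq M) : set M :=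
  \bigcap_(U in [set U | submodule U /\ forall x, x \in s -> U x]) U.

Lemma submodule_gen s : submodule (submod_gen s).
Proof. by apply: submodule_bigcap => U []. Qed.

Lemma mem_submod_gen (s : seq M) x : x \in s -> submod_gen s x.
Proof. by move=> xs U [_ /(_ _ xs)]. Qed.

Lemma sub_submod_gen (s1 s2 : seq M) :
  {subset s1 <= s2} -> submod_gen s1 `<=` submod_gen s2.
Proof. by move=> ss x s1x U [sU Us]; apply: s1x; split=> // y /ss /Us. Qed.

(** This form mentions no coefficients, so it can be compared along a lattice isomorphism. *)
Lemma finitely_generatedP :
  finitely_generated M <-> exists s, submod_gen s = setT.
Proof.
split=> [[n [g gM]]|[s sM]].
  exists [seq g i | i <- enum 'I_n]; apply/seteqP; split=> // x _ U [sU Ug].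
  have [c ->] := gM x; apply: submodule_sum => // i _; apply: submoduleZ => //.
  by apply: Ug; apply: map_f; rewrite mem_enum.
exists (size s), (fun i => s`_i) => x.
pose U : set M := [set x | exists c : 'I_(size s) -> R, x = \sum_i c i *: s`_i].
have : submod_gen s x by rewrite sM.
move/(_ U); apply; split.
  split=> [|a y z [c ->] [d ->]].
    by exists (fun=> 0); rewrite big1 // => i _; rewrite scale0r.
  exists (fun i => a * c i + d i); rewrite scaler_sumr -big_split /=.
  by apply: eq_bigr => i _; rewrite scalerDl scalerA.
move=> y ys; have sy : (index y s < size s)%N by rewrite index_mem.
exists (fun i => if i == Ordinal sy then 1 else 0).
rewrite (bigD1 (Ordinal sy)) //= eqxx scale1r nth_index // big1 ?addr0 //.
by move=> i /negPf ->; rewrite scale0r.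
Qed.

End SubmoduleTheory.

(* An isomorphism between the lattices of submodules of [M] and [N]; the values
   of the two maps on sets that are not submodules are irrelevant. *)
Record submodule_iso (R S : pzRingType) (M : lmodType R) (N : lmodType S)
    (f : set M -> set N) (g : set N -> set M) : Prop := SubmoduleIso {
  iso_sub : forall U, submodule U -> submodule (f U);
  iso_subV : forall V, submodule V -> submodule (g V);
  iso_le : forall U U', submodule U -> submodule U' -> U `<=` U' -> f U `<=` f U';
  iso_leV : forall V V', submodule V -> submodule V' -> V `<=` V' -> g V `<=` g V';
  isoK : forall U, submodule U -> g (f U) = U;
  isoVK : forall V, submodule V -> f (g V) = V }.

Lemma submodule_iso_sym (R S : pzRingType) (M : lmodType R) (N : lmodType S)
    (f : set M -> set N) (g : set N -> set M) :
  submodule_iso f g -> submodule_iso g f.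
Proof. by case. Qed.

Section SubmoduleIsoTheory.
Variables (R S : pzRingType) (M : lmodType R) (N : lmodType S).
Variables (f : set M -> set N) (g : set N -> set M).
Hypothesis fg : submodule_iso f g.

(** An order isomorphism is a Galois connection; the lemmas on zero, maximal submodules, sums and
    radicals reduce to this. *)
Lemma iso_adj U V : submodule U -> submodule V -> (f U `<=` V <-> U `<=` g V).
Proof.
move=> sU sV; split=> h.
  rewrite -(isoK fg sU); apply: (iso_leV fg) => //; exact: (iso_sub fg).
rewrite -(isoVK fg sV); apply: (iso_le fg) => //; exact: (iso_subV fg).
Qed.

Lemma iso_setT : f setT = setT.
Proof.
apply/seteqP; split=> //; rewrite -{1}(isoVK fg (submodule_setT N)).
apply: (iso_le fg) => //; exact: (iso_subV fg).
Qed.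

Lemma iso_zero : f [set 0] = [set 0].
Proof.
have s0 := submodule_zero M; have s0' := submodule_zero N.
apply/seteqP; split.
  by apply/iso_adj => // x ->; apply: submodule0; exact: (iso_subV fg).
by move=> x ->; apply: submodule0; exact: (iso_sub fg).
Qed.

Lemma iso_inj U V : submodule U -> submodule V -> f U = f V -> U = V.
Proof. by move=> sU sV e; rewrite -(isoK fg sU) e isoK. Qed.

Lemma iso_maximal U : maximal_submodule U -> maximal_submodule (f U).
Proof.
move=> [sU nU mU]; split; first exact: (iso_sub fg).
  by rewrite -iso_setT => e; exact: nU (iso_inj sU (submodule_setT M) e).
move=> V sV UV; have sgV := iso_subV fg sV.
have [||<-|e] := mU (g V); [by []|exact/iso_adj|by left; rewrite isoVK|right].
by rewrite -(isoVK fg sV) e iso_setT.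
Qed.

Lemma iso_simple U : simple_submodule U -> simple_submodule (f U).
Proof.
move=> [sU nU mU]; split; first exact: (iso_sub fg).
  by rewrite -iso_zero => e; exact: nU (iso_inj sU (submodule_zero M) e).
move=> V sV VU; have sgV := iso_subV fg sV.
have [||e|<-] := mU (g V); [by []| |left|by right; rewrite isoVK].
  by rewrite -(isoK fg sU); apply: (iso_leV fg) => //; exact: (iso_sub fg).
by rewrite -(isoVK fg sV) e iso_zero.
Qed.

Lemma iso_I U V : submodule U -> submodule V -> f (U `&` V) = f U `&` f V.
Proof.
move=> sU sV; have sUV := submoduleI sU sV.
have [sfU sfV] := (iso_sub fg sU, iso_sub fg sV).
apply/seteqP; split.
  by rewrite subsetI; split; apply: (iso_le fg) => // x [].
rewrite -(isoVK fg (submoduleI sfU sfV)).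
apply: (iso_le fg) => //; first by apply: (iso_subV fg) => //; exact: submoduleI.
rewrite subsetI -[X in _ `<=` X /\ _](isoK fg sU) -[X in _ /\ _ `<=` X](isoK fg sV).
by split; apply: (iso_leV fg) => //; try exact: submoduleI; move=> x [].
Qed.

Lemma iso_uniserial U : uniserial_submodule U -> uniserial_submodule (f U).
Proof.
move=> [sU uU]; split=> [|V W sV sW VU WU]; first exact: (iso_sub fg).
have [sgV sgW] := (iso_subV fg sV, iso_subV fg sW).
have gU X : submodule X -> X `<=` f U -> g X `<=` U.
  by move=> sX h; rewrite -(isoK fg sU); apply: (iso_leV fg) => //; exact: (iso_sub fg).
have [h|h] := uU _ _ sgV sgW (gU _ sV VU) (gU _ sW WU); [left|right].
  by rewrite -(isoVK fg sV) -(isoVK fg sW); exact: (iso_le fg).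
by rewrite -(isoVK fg sV) -(isoVK fg sW); exact: (iso_le fg).
Qed.

(** A sum of submodules is their join, hence determined by the order. *)
Lemma iso_submod_sum l (U : 'I_l -> set M) : (forall i, submodule (U i)) ->
  f (submod_sum U) = submod_sum (fun i => f (U i)).
Proof.
move=> sU; have sfU i := iso_sub fg (sU i).
have sS := submodule_submod_sum sU; have sS' := submodule_submod_sum sfU.
apply/seteqP; split.
  apply/iso_adj => //; apply: submod_sum_le => [|i]; first exact: (iso_subV fg).
  by apply/iso_adj => //; exact: (submod_sum_ge (U := fun i => f (U i))).
apply: submod_sum_le => [|i]; first exact: (iso_sub fg).
by apply: (iso_le fg) => //; exact: submod_sum_ge.
Qed.

End SubmoduleIsoTheory.

Lemma iso_mod_rad (R S : pzRingType) (M : lmodType R) (N : lmodType S)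
    (f : set M -> set N) (g : set N -> set M) :
  submodule_iso f g -> f (mod_rad M) = mod_rad N.
Proof.
move=> fg; have gf := submodule_iso_sym fg.
have [sM sN] := (submodule_mod_rad M, submodule_mod_rad N).
apply/seteqP; split.
  move=> y fy V mV; have [sV _ _] := mV; move: y fy.
  by apply/(iso_adj fg) => // x; apply; exact: (iso_maximal gf).
apply/(iso_adj gf) => // x gx U mU; have [sU _ _] := mU; move: x gx.
by apply/(iso_adj gf) => // y; apply; exact: (iso_maximal fg).
Qed.

Lemma iso_multiserial (R S : pzRingType) (M : lmodType R) (N : lmodType S)
    (f : set M -> set N) (g : set N -> set M) :
  submodule_iso f g -> multiserial M -> multiserial N.
Proof.
move=> fg [l [U [uU radU IU]]]; have sU i : submodule (U i) by case: (uU i).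
exists l, (fun i => f (U i)); split=> [i||i j ij].
- exact: (iso_uniserial fg).
- by rewrite -(iso_submod_sum fg) // -radU (iso_mod_rad fg).
- rewrite -(iso_I fg) //; have [->|sUij] := IU i j ij.
    by left; exact: (iso_zero fg).
  by right; exact: (iso_simple fg).
Qed.

(* Being finitely generated is compactness in the lattice of submodules. *)
Lemma iso_finitely_generated (R S : pzRingType) (M : lmodType R)
    (N : lmodType S) (f : set M -> set N) (g : set N -> set M) :
  submodule_iso f g -> finitely_generated M -> finitely_generated N.
Proof.
move=> fg [n [c cM]]; apply/finitely_generatedP.
(* [U] is a directed union. It turns out to be all of [M], so each generator [c i] occurs at some
   stage [s i], and the concatenation of these lists generates [N]. *)
pose U : set M := [set x | exists s, g (submod_gen s) x].
have sg s := iso_subV fg (submodule_gen s).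
have mono s1 s2 : {subset s1 <= s2} -> g (submod_gen s1) `<=` g (submod_gen s2).
  by move=> ss; apply: (iso_leV fg); [exact: submodule_gen..|exact: sub_submod_gen].
have sU : submodule U.
  split=> [|a x y [s sx] [t ty]]; first by exists [::]; exact: submodule0.
  exists (s ++ t); apply: (sg _).2; [apply: mono sx|apply: mono ty] => z zs;
  by rewrite mem_cat zs ?orbT.
have UT : U = setT.
  apply: (iso_inj fg) => //; rewrite (iso_setT fg); apply/seteqP; split=> // y _.
  have : submod_gen [:: y] y by apply: mem_submod_gen; rewrite mem_head.
  rewrite -(isoVK fg (submodule_gen _)); apply: (iso_le fg) => //.
  by move=> x; exists [:: y].
have /choice[s sc] i : exists s, g (submod_gen s) (c i).
  by have : U (c i) by rewrite UT.
exists (flatten [seq s i | i <- enum 'I_n]).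
apply: (iso_inj (submodule_iso_sym fg)); [exact: submodule_gen|by []|].
rewrite (iso_setT (submodule_iso_sym fg)); apply/seteqP; split=> // x _.
have [d ->] := cM x; apply: submodule_sum => // i _; apply: submoduleZ => //.
apply: mono (sc i) => y yi; apply/flatten_mapP; exists i => //.
by rewrite mem_enum.
Qed.

Lemma exists_submodule_max_avoiding (R : pzRingType) (M : lmodType R)
    (V : set M) (x : M) : submodule V -> ~ V x ->
  exists U, [/\ submodule U, V `<=` U, ~ U x &
    forall W, submodule W -> U `<=` W -> ~ W x -> W = U].
Proof.
move=> sV nVx.
(* Zorn's lemma is applied to the sets added to [V], so that the empty chain, whose union is [set0],
   is covered too. *)
pose P := [set X : set M | submodule (V `|` X) /\ ~ (V `|` X) x].
have P0 : P set0 by split; rewrite setU0.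
have [F FP Ftot|U [[sU nUx] mU]] := Zorn_bigcup (P := P).
  pose F' X := F X \/ X = set0.
  have F'P X : F' X -> P X by case=> [/FP|->].
  have mem y : (V `|` \bigcup_(X in F) X) y -> exists2 X, F' X & (V `|` X) y.
    by case=> [Vy|[X FX Xy]]; [exists set0; [right|left]|exists X; [left|right]].
  have mem' X y : F' X -> (V `|` X) y -> (V `|` \bigcup_(X in F) X) y.
    by move=> [FX|->] [Vy|Xy] //; [left|right; exists X|left].
  split=> [|/mem[X /F'P[_ nXx] /nXx]//]; split=> [|a y z].
    by left; exact: submodule0.
  move=> /mem[X FX Xy] /mem[Y FY Yz].
  have tot : X `<=` Y \/ Y `<=` X.
    by case: FX => [FX|->]; [case: FY => [FY|->]; [exact: Ftot|right]|left].
  have [sX sY] := ((F'P _ FX).1, (F'P _ FY).1).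
  case: tot => XY; [apply: (mem' Y _ FY)|apply: (mem' X _ FX)].
    by apply: sY.2 => //; apply: setUS Xy.
  by apply: sX.2 => //; apply: setUS Yz.
exists (V `|` U); split=> // W sW UW nWx.
have eW : V `|` W = W by apply/setUidPr => y Vy; apply: UW; left.
apply: contrapT => WU; apply: (mU W); last by split; rewrite eW.
split; first by move=> y Uy; apply: UW; right.
by move=> WsU; apply: WU; apply/seteqP; split=> // y /WsU; right.
Qed.

(** * Invariance under equivalences of module categories *)

Section SubmoduleType.
Variables (R : pzRingType) (M : lmodType R) (U : set M) (sU : submodule U).

(* The unused proof argument lets canonical structures recover [sU]. *)
Definition submodule_pred of submodule U : pred M := fun x => `[< U x >].

Lemma submodule_pred_closed : submod_closed (submodule_pred sU).
Proof.
split=> [|a x y]; rewrite /in_mem /= /submodule_pred.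
  by apply/asboolP; exact: submodule0.
by move=> /asboolP Ux /asboolP Uy; apply/asboolP; exact: sU.2.
Qed.

HB.instance Definition _ := GRing.isSubmodClosed.Build R M
  (submodule_pred sU) submodule_pred_closed.

Definition submod := {x : M | submodule_pred sU x}.

HB.instance Definition _ := SubChoice.on submod.
HB.instance Definition _ := [SubChoice_isSubLmodule of submod by <:].

Definition submod_incl : {linear submod -> M} := val.

Lemma submod_incl_inj : injective submod_incl.
Proof. exact: val_inj. Qed.

Lemma range_submod_incl : range submod_incl = U.
Proof.
apply/seteqP; split=> [_ [x _ <-]|x Ux]; first exact/asboolP/(valP x).
have px : submodule_pred sU x by exact/asboolP.
by exists (exist _ x px).
Qed.

End SubmoduleType.

Lemma submodule_range (R : pzRingType) (M N : lmodType R) (f : {linear M -> N}) :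
  submodule (range f).
Proof.
split; first by exists 0; rewrite ?linear0.
by move=> a _ _ [x _ <-] [y _ <-]; exists (a *: x + y); rewrite ?linearP.
Qed.

(** Injectivity of [f] makes the chosen preimages unique, hence linear in [y]. *)
Lemma linear_factor (R : pzRingType) (M X Y : lmodType R)
    (f : {linear X -> M}) (g : {linear Y -> M}) :
  injective f -> range g `<=` range f ->
  exists h : {linear Y -> X}, forall y, f (h y) = g y.
Proof.
move=> fI gf.
have /choice[h hE] y : exists x, f x = g y.
  by have [x _ <-] := gf (g y) (imageT g y); exists x.
have hl : linear h by move=> a x y; apply: fI; rewrite linearP !hE linearP.
pose hL := GRing.isLinear.Build R Y X *:%R h hl.
pose hlin : {linear Y -> X} := HB.pack h hL.
by exists hlin.
Qed.

Section ScaleVec.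
Variables (R : pzRingType) (M : lmodType R) (x : M).
(** Turns an element into a morphism from the regular module, on which functors can act. *)
Definition scale_vec (a : R^o) : M := (a : R) *: x.
Lemma scale_vec_linear : linear scale_vec.
Proof. by move=> a b c; rewrite /scale_vec scalerDl scalerA. Qed.
HB.instance Definition _ := GRing.isLinear.Build R R^o M *:%R scale_vec
  scale_vec_linear.
End ScaleVec.

Section FunctorImage.
Variables (R S : pzRingType) (F : mod_functor R S).

(* For a submodule [U] this is the range of [fmap F i], [i] being the inclusion
   of [U] in [M]. *)
Definition functor_image (M : lmodType R) (U : set M) : set (F M) :=
  [set y | exists (X : lmodType R) (f : {linear X -> M}),
    range f `<=` U /\ range (fmap F f) y].

Arguments functor_image {M}.

Lemma functor_image_le (M : lmodType R) (U V : set M) :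
  U `<=` V -> functor_image U `<=` functor_image V.
Proof.
by move=> UV y [X [f [fU yf]]]; exists X, f; split=> //; exact: subset_trans UV.
Qed.

(** Every map with range inside [range f] factors through [f], and [F] preserves the
    factorization. *)
Lemma functor_image_range (X M : lmodType R) (f : {linear X -> M}) :
  injective f -> functor_image (range f) = range (fmap F f).
Proof.
move=> fI; apply/seteqP; split=> [y [Y [g [gf [z _ <-]]]]|y yf]; last first.
  by exists X, f; split.
have [h hE] := linear_factor fI gf; exists (fmap F h z) => //.
rewrite -[LHS](@fmap_comp _ _ F _ _ _ h f z).
apply: fmap_ext => u; exact: hE.
Qed.

Lemma submodule_functor_image (M : lmodType R) (U : set M) :
  submodule U -> submodule (functor_image U).
Proof.
move=> sU; rewrite -(range_submod_incl sU).
by rewrite (functor_image_range (@submod_incl_inj _ _ _ sU)); exact: submodule_range.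
Qed.

End FunctorImage.

Arguments functor_image {R S} F {M}.

Section Equivalence.
Variables (R S : pzRingType) (F : mod_functor R S) (G : mod_functor S R).

(* Functors preserve monomorphisms when they have a left inverse, and linear
   monomorphisms are injective because the regular module is a generator. *)
Lemma fmap_inj :
  nat_isomorphic (comp_functor G F) (id_functor R) ->
  nat_isomorphic (comp_functor F G) (id_functor S) ->
  forall (M N : lmodType R) (f : {linear M -> N}),
  injective f -> injective (fmap F f).
Proof.
move=> [phi [psi [phiK psiK phiN]]] [phi' [psi' [phiK' psiK' phiN']]] M N f fI x y exy.
(* By naturality, [phi] conjugates [fmap G (fmap F f)] to [f]. *)
have GFfI : injective (fmap G (fmap F f)).
  move=> u v euv; apply: (can_inj (phiK M)); apply: fI.
  have := phiN M N f u; have := phiN M N f v => /= <- <-.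
  by congr (phi N _).
pose hx : {linear S^o -> F M} := scale_vec x.
pose hy : {linear S^o -> F M} := scale_vec y.
(* [hx] and [hy] agree after composition with [fmap F f], so [GFfI] equates their images under [G].
   Applying [F] and evaluating at the element matching 1 then gives [x = y]. *)
have Gxy : fmap G hx =1 fmap G hy.
  move=> u; apply: GFfI.
  rewrite -[LHS](@fmap_comp _ _ G _ _ _ hx (fmap F f) u).
  rewrite -[RHS](@fmap_comp _ _ G _ _ _ hy (fmap F f) u).
  apply: fmap_ext => a /=.
  by rewrite /scale_vec !linearZ exy.
have : fmap F (fmap G hx) =1 fmap F (fmap G hy) by exact: fmap_ext.
move=> /(_ (psi' (S^o : lmodType S) (1 : S))) e.
have := phiN' _ _ hx (psi' (S^o : lmodType S) (1 : S)).
have := phiN' _ _ hy (psi' (S^o : lmodType S) (1 : S)).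
by rewrite /= e => -> /=; rewrite psiK' /scale_vec !scale1r.
Qed.

(** Naturality identifies the image under [G] and [F] of the inclusion of [U] with that inclusion
    itself. *)
Lemma image_functor_image (phi : forall M : lmodType R, {linear G (F M) -> M})
    (psi : forall M : lmodType R, {linear M -> G (F M)}) (M : lmodType R) U :
  (forall M, cancel (psi M) (phi M)) ->
  (forall (M N : lmodType R) (f : {linear M -> N}),
     phi N \o fmap G (fmap F f) =1 f \o phi M) ->
  (forall (M N : lmodType R) (f : {linear M -> N}),
     injective f -> injective (fmap F f)) ->
  submodule U -> phi M @` functor_image G (functor_image F U) = U.
Proof.
move=> psiK phiN Finj sU; pose i := submod_incl sU.
have iI : injective i by exact: submod_incl_inj.
have iU : range i = U := range_submod_incl sU.
rewrite -{1}iU functor_image_range //.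
rewrite functor_image_range; last exact: Finj.
apply/seteqP; split=> [_ [_ [z _ <-] <-]|x].
  have := phiN _ _ i z => /= ->.
  by rewrite -[X in X _]iU; exists (phi _ z).
rewrite -[X in X _]iU => -[u _ <-].
exists (fmap G (fmap F i) (psi _ u)); first by exists (psi _ u).
by have := phiN _ _ i (psi _ u) => /= ->; rewrite psiK.
Qed.

End Equivalence.

(** The inverse takes the [G]-image and pushes it to [M] by [phi M]. One composite is the identity
    by [image_functor_image]; the other follows because this inverse is injective. *)
Lemma equivalence_submodule_iso (R S : pzRingType) (F : mod_functor R S)
    (G : mod_functor S R) (M : lmodType R) :
  nat_isomorphic (comp_functor G F) (id_functor R) ->
  nat_isomorphic (comp_functor F G) (id_functor S) ->
  exists g : set (F M) -> set M, submodule_iso (functor_image F (M := M)) g.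
Proof.
move=> nGF nFG; have Fi := fmap_inj nGF nFG; have Gi := fmap_inj nFG nGF.
have [phi [psi [phiK psiK phiN]]] := nGF.
have [phi' [psi' [phiK' psiK' phiN']]] := nFG.
have FK U : submodule U -> phi M @` functor_image G (functor_image F U) = U.
  exact: (image_functor_image psiK phiN Fi).
have GK (W : set (F M)) : submodule W ->
    phi' (F M) @` functor_image F (functor_image G W) = W.
  exact: (image_functor_image psiK' phiN' Gi).
pose g (W : set (F M)) := phi M @` functor_image G W.
have gsub W : submodule W -> submodule (g W).
  move=> /(@submodule_functor_image _ _ G) sW; split.
    by exists 0; [exact: submodule0|rewrite linear0].
  move=> a _ _ [x Wx <-] [y Wy <-]; exists (a *: x + y); last by rewrite linearP.
  exact: sW.2.
have gle (V W : set (F M)) : V `<=` W -> g V `<=` g W.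
  by move=> VW; apply: image_subset; exact: functor_image_le.
have ginj (V W : set (F M)) : submodule V -> submodule W -> g V = g W -> V = W.
  move=> sV sW eG.
  have gP X y : functor_image G X y <-> g X (phi M y).
    split=> [Xy|[z Xz e]]; first by exists y.
    by rewrite -(can_inj (phiK M) e).
  have eV : functor_image G V = functor_image G W.
    by apply/seteqP; split=> y /gP Vy; apply/gP; move: Vy; rewrite eG.
  by rewrite -(GK V) // eV GK.
exists g; split=> //.
- exact: submodule_functor_image.
- by move=> U U' _ _; exact: functor_image_le.
- by move=> V W _ _; exact: gle.
- move=> W sW; apply: ginj => //; first exact/submodule_functor_image/gsub.
  by rewrite /g FK //; exact: gsub.
Qed.

(** * Modules over a bound quiver algebra *)

Section PathAlgebraTheory.
Variables (K : fieldType) (Q : quiver).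
Implicit Types (x : path_alg K Q) (a : arrow Q) (v : vertex Q).

(** The arrow split off is the first of the path, the one that acts first on a right module. *)
Lemma path_elt_ind (P : path_alg K Q -> Prop) :
  (forall v, P (path_elt K (trivial_path v))) ->
  (forall a p, P (path_elt K p) -> P (arrow_elt K a * path_elt K p)) ->
  forall p, P (path_elt K p).
Proof.
move=> P0 PS [[v w] wP]; elim: w v wP => [|a w IHw] v wP.
  by have := P0 v; congr (P (path_elt K _)); apply: val_inj.
have wP' : walk (target a) w by move: wP => /= /andP[].
have := PS a _ (IHw (target a) wP'); rewrite path_eltM.
set o := pcat _ _; suff -> : o = Some (exist _ (v, a :: w) wP) by [].
apply/pcatP; split=> //=; rewrite /pstart /parrows /=.
by move: wP => /= /andP[/eqP ->].
Qed.

Lemma trivial_mul_arrow v a :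
  path_elt K (trivial_path v) * arrow_elt K a =
  if v == source a then arrow_elt K a else 0.
Proof. by rewrite path_eltM pcat_trivl; case: ifP. Qed.

Lemma arrow_mul_trivial v a :
  arrow_elt K a * path_elt K (trivial_path v) =
  if v == target a then arrow_elt K a else 0.
Proof. by rewrite path_eltM pcat_trivr; case: ifP. Qed.

Lemma trivial_mul_trivial v w :
  path_elt K (trivial_path v) * path_elt K (trivial_path w) =
  if w == v then path_elt K (trivial_path v) else 0.
Proof. by rewrite path_eltM pcat_trivr; case: ifP. Qed.

Definition word_elt (s : seq (arrow Q)) : path_alg K Q :=
  foldr (fun a x => arrow_elt K a * x) 1 s.

Lemma word_elt_exp s : ideal_exp (arrow_ideal (K := K) (Q := Q)) (size s) (word_elt s).
Proof.
elim: s => //= a s IHs; move=> J; apply; exists (arrow_elt K a), (word_elt s).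
by split=> // J'; apply; exists a.
Qed.

End PathAlgebraTheory.

(** * The right action of the path algebra *)

Section RightAction.
Variables (K : fieldType) (Q : quiver) (I : ideal (path_alg K Q)).
Variable M : lmodType (quot_ring I)^c.
Implicit Types (x y z : M) (r s : path_alg K Q) (a b : arrow Q).
Implicit Types (U V W : set M).

(** The path algebra acts, rather than its quotient, so that induction on paths applies; a scalar
    [c] acts as [c *: 1]. *)
Definition act x r : M := (quot_proj I r : (quot_ring I)^c) *: x.
Local Notation "x *> r" := (act x r) (at level 40, left associativity).
Local Notation "x .* a" := (act x (arrow_elt K a)) (at level 40, left associativity).
Local Notation "c ** x" := (act x (c *: (1 : path_alg K Q))) (at level 40).

Lemma actA x r s : x *> r *> s = x *> (r * s).
Proof. by rewrite /act scalerA; congr (_ *: _); exact: quot_projM. Qed.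

Lemma act1 x : x *> 1 = x. Proof. exact: scale1r. Qed.

Lemma actDl x y r : (x + y) *> r = x *> r + y *> r.
Proof. exact: scalerDr. Qed.

Lemma actBl x y r : (x - y) *> r = x *> r - y *> r.
Proof. exact: scalerBr. Qed.

Lemma act0l r : 0 *> r = 0. Proof. exact: scaler0. Qed.

Lemma actDr x r s : x *> (r + s) = x *> r + x *> s.
Proof. by rewrite /act quot_projD; exact: scalerDl. Qed.

Lemma act_ideal x r : I r -> x *> r = 0.
Proof.
move=> Ir; rewrite /act (_ : quot_proj I r = 0) ?scale0r //.
have <- : quot_proj I 0 = 0 by exact: raddf0.
by apply/quot_projP; rewrite subr0.
Qed.

Lemma act0r x : x *> 0 = 0. Proof. by apply: act_ideal; exact: ideal_0. Qed.

Lemma act_suml (J : Type) (t : seq J) (f : J -> M) r :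
  (\sum_(i <- t) f i) *> r = \sum_(i <- t) f i *> r.
Proof. exact: scaler_sumr. Qed.

Lemma act_sumr (J : Type) (t : seq J) (f : J -> path_alg K Q) x :
  x *> (\sum_(i <- t) f i) = \sum_(i <- t) x *> f i.
Proof. by apply: (big_morph (act x)) => [r s|]; [exact: actDr|exact: act0r]. Qed.

Lemma actZr c x r : x *> (c *: r) = c ** (x *> r).
Proof. by rewrite actA -path_scaleAr mulr1. Qed.

Lemma actZl c x r : (c ** x) *> r = c ** (x *> r).
Proof. by rewrite !actA -path_scaleAl -path_scaleAr mulr1 mul1r. Qed.

Lemma actZK c x : c != 0 -> c^-1 ** (c ** x) = x.
Proof.
by move=> c0; rewrite actA -path_scaleAl mul1r scalerA mulfV // scale1r act1.
Qed.

Lemma act_trivial x : x = \sum_(v : vertex Q) x *> path_elt K (trivial_path v).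
Proof. by rewrite -act_sumr -[LHS]act1. Qed.

Lemma submodule_act U x r : submodule U -> U x -> U (x *> r).
Proof. exact: submoduleZ. Qed.

Lemma submodule_actP U : U 0 -> (forall x y, U x -> U y -> U (x + y)) ->
  (forall x r, U x -> U (x *> r)) -> submodule U.
Proof.
move=> U0 UD UA; split=> // a x y Ux Uy; apply: UD => //.
by rewrite -(quot_projK (a : quot_ring I)); exact: UA.
Qed.

(** Scalars, trivial paths and arrows generate the path algebra. *)
Lemma submodule_arrowP U : U 0 -> (forall x y, U x -> U y -> U (x + y)) ->
  (forall c x, U x -> U (c ** x)) ->
  (forall v x, U x -> U (x *> path_elt K (trivial_path v))) ->
  (forall a x, U x -> U (x .* a)) -> submodule U.
Proof.
move=> U0 UD UZ Ut Ua; apply: submodule_actP => // x r.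
elim/path_alg_ind: r x => [|c p r IHr] x Ux; first by rewrite act0r.
rewrite actDr actZr; apply: UD; [apply: UZ|exact: IHr].
have {}h : forall x, U x -> U (x *> path_elt K p); last exact: h.
elim/path_elt_ind: (path_elt K p) {x r IHr Ux} => [v x|a q IHq x Ux]; first exact: Ut.
by rewrite -actA; apply: IHq; exact: Ua.
Qed.

(** * Cyclic submodules and the radical *)

Definition cyclic x : set M := range (act x).

Lemma submodule_cyclic x : submodule (cyclic x).
Proof.
apply: submodule_actP.
- by exists 0 => //; exact: act0r.
- by move=> _ _ [r _ <-] [s _ <-]; exists (r + s) => //; exact: actDr.
- by move=> _ s [r _ <-]; exists (r * s) => //; rewrite actA.
Qed.

Lemma mem_cyclic x : cyclic x x.
Proof. by exists 1 => //; exact: act1. Qed.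

Lemma cyclic_le U x : submodule U -> U x -> cyclic x `<=` U.
Proof. by move=> sU Ux _ [r _ <-]; exact: submodule_act. Qed.

Lemma cyclic0 : cyclic 0 = [set 0].
Proof.
apply/seteqP; split=> [_ [r _ <-]|_ ->]; first exact: act0l.
exact: mem_cyclic.
Qed.

(** This is [M J] for the ideal [J] generated by the arrows; terms ending in the same arrow are
    collected into one. *)
Definition arrow_rad : set M :=
  [set x | exists f : arrow Q -> M, x = \sum_a f a .* a].

Lemma mem_arrow_rad x a : arrow_rad (x .* a).
Proof.
exists (fun b => if b == a then x else 0).
rewrite (bigD1 a) //= eqxx big1 ?addr0 // => b /negPf ->; exact: act0l.
Qed.

Lemma arrow_rad_le U : submodule U -> (forall x a, U (x .* a)) -> arrow_rad `<=` U.
Proof. by move=> sU Ua _ [f ->]; apply: submodule_sum. Qed.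

Lemma submodule_arrow_rad : submodule arrow_rad.
Proof.
have D x y : arrow_rad x -> arrow_rad y -> arrow_rad (x + y).
  move=> [f ->] [g ->]; exists (fun a => f a + g a); rewrite -big_split.
  by apply: eq_bigr => a _; rewrite actDl.
have R0 : arrow_rad 0.
  by exists (fun=> 0); rewrite big1 // => a _; exact: act0l.
apply: submodule_arrowP => // [c x [f ->]|v x [f ->]|a x _].
- exists (fun a => c ** f a); rewrite act_suml; apply: eq_bigr => a _.
  by rewrite actZl.
- exists (fun a => if v == target a then f a else 0).
  rewrite act_suml; apply: eq_bigr => a _; rewrite actA arrow_mul_trivial.
  by case: eqP => // _; rewrite act0r act0l.
- exact: mem_arrow_rad.
Qed.

(* Modulo [arrow_rad], the algebra acts on [x e_w] by scalars. *)
Lemma act_trivial_decomp x w r : let z := x *> path_elt K (trivial_path w) in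
  exists c : K, arrow_rad (z *> r - c ** z).
Proof.
move=> z; have sJ := submodule_arrow_rad.
elim/path_alg_ind: r => [|c p r [d IHr]].
  by exists 0; rewrite scale0r !act0r subrr; exact: submodule0.
have [e Je] : exists e : K, arrow_rad (z *> path_elt K p - e ** z).
  elim/path_elt_ind: (path_elt K p) => [v|a q _].
    exists (v == w)%:R; rewrite /z actA trivial_mul_trivial.
    case: eqP => _; rewrite ?scale0r ?scale1r ?act0r ?act1 subrr;
    exact: submodule0.
  exists 0; rewrite scale0r act0r subr0 -actA; apply: submodule_act => //.
  exact: mem_arrow_rad.
exists (c * e + d); rewrite actDr scalerDl actDr opprD addrACA.
apply: submoduleD => //; rewrite -scalerA (actZr _ _ (path_elt K p)) (actZr _ _ (e *: _)).
by rewrite -actBl; exact: submodule_act.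
Qed.

(** A submodule [U] containing [arrow_rad] and maximal among those avoiding [x] is a maximal
    submodule. Indeed, let [V] be strictly larger, so that [x] is in [V]. If some [z = t e_w] were
    outside [V], maximality of [U] would give [x = u + z r], and [z r] is [c z] modulo [arrow_rad]:
    [c = 0] puts [x] in [U], and otherwise [z] is in [V]. *)
Lemma mod_rad_sub_arrow_rad : mod_rad M `<=` arrow_rad.
Proof.
have sJ := submodule_arrow_rad.
move=> x Rx; apply: contrapT => nJx.
have [U [sU JU nUx mU]] := exists_submodule_max_avoiding sJ nJx.
apply: (nUx); apply: Rx; split=> //; first by move=> UT; apply: nUx; rewrite UT.
move=> V sV UV; have [Vx|nVx] := pselect (V x); last by left; exact: mU.
right; apply/seteqP; split=> // t _; rewrite [t]act_trivial.
apply: submodule_sum => // w _; apply: contrapT.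
set z := t *> _ => nVz.
pose W := [set y | exists2 u, U u & exists r, y = u + z *> r].
have sW : submodule W.
  apply: submodule_actP.
  - by exists 0; [exact: submodule0|exists 0; rewrite act0r addr0].
  - move=> _ _ [u Uu [r ->]] [u' Uu' [r' ->]]; exists (u + u').
      exact: submoduleD.
    by exists (r + r'); rewrite actDr addrACA.
  - move=> _ s [u Uu [r ->]]; exists (u *> s); first exact: submodule_act.
    by exists (r * s); rewrite actDl actA.
have UW : U `<=` W by move=> u Uu; exists u => //; exists 0; rewrite act0r addr0.
have [u Uu [r xE]] : W x.
  apply: contrapT => nWx; apply: nVz; apply: UV; rewrite -(mU W) //.
  by exists 0; [exact: submodule0|exists 1; rewrite act1 add0r].
have [c Jc] := act_trivial_decomp t w r; rewrite -/z in Jc.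
have Vcz : V (c ** z).
  have -> : c ** z = x - u - (z *> r - c ** z).
    by rewrite opprB xE [u + _]addrC addrK [RHS]addrC subrK.
  apply: submoduleB => //; last by apply: UV; exact: JU.
  by apply: submoduleB => //; exact: UV.
have [c0|c0] := eqVneq c 0; last first.
  by apply: nVz; rewrite -(actZK z c0); exact: submodule_act.
apply: nUx; rewrite xE; apply: submoduleD => //; apply: JU.
by move: Jc; rewrite c0 scale0r act0r subr0.
Qed.

Section Nilpotent.
Variable n : nat.
Hypothesis In : ideal_exp (arrow_ideal (K := K) (Q := Q)) n `<=` I.

(** Nakayama's argument: a maximal [U] missing an element of [M J] satisfies [U + M J = M], hence
    [U + M J^n = M], while [M J^n = 0]. *)
Lemma arrow_rad_sub_mod_rad : arrow_rad `<=` mod_rad M.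
Proof.
have sJ := submodule_arrow_rad.
move=> x Jx U [sU nUT mU]; apply: contrapT => nUx.
pose V := [set y | exists2 u, U u & exists2 j, arrow_rad j & y = u + j].
have sV : submodule V.
  apply: submodule_actP.
  - exists 0; first exact: submodule0.
    by exists 0; rewrite ?addr0 //; exact: submodule0.
  - move=> _ _ [u Uu [r Jr ->]] [u' Uu' [r' Jr' ->]]; exists (u + u').
      exact: submoduleD.
    by exists (r + r'); [exact: submoduleD|rewrite addrACA].
  - move=> _ s [u Uu [r Jr ->]]; exists (u *> s); first exact: submodule_act.
    by exists (r *> s); [exact: submodule_act|rewrite actDl].
have UV : U `<=` V.
  by move=> u Uu; exists u => //; exists 0; [exact: submodule0|rewrite addr0].
have [VU|VT] := mU V sV UV.
  apply: nUx; rewrite -VU; exists 0; first exact: submodule0.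
  by exists x; rewrite ?add0r.
(* [d] counts the arrows still missing from a word of length [n]; a word of length [n] lies in [I]
   and acts as 0. *)
have word d w y : (size w + d = n)%N -> U (y *> word_elt K w).
  elim: d w y => [|d IHd] w y sz.
    rewrite act_ideal; first exact: submodule0.
    by apply: In; rewrite -sz addn0; exact: word_elt_exp.
  have [u Uu [_ [f ->] ->]] : V y by rewrite VT.
  rewrite actDl act_suml; apply: submoduleD => //; first exact: submodule_act.
  apply: submodule_sum => // a _; rewrite actA.
  by apply: (IHd (a :: w)); rewrite -sz addSnnS.
by apply: nUx; have := word n [::] x (add0n n); rewrite act1.
Qed.

Lemma mod_radE : mod_rad M = arrow_rad.
Proof.
apply/seteqP; split; [exact: mod_rad_sub_arrow_rad|exact: arrow_rad_sub_mod_rad].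
Qed.

(** * Chains and the uniserial modules x a A *)

Hypothesis IM : condition_M I.

(** The default [a] is harmless: it occurs only when [a] times any arrow acts as 0. *)
Definition nxt a : arrow Q :=
  odflt a [pick b | `[< ~ I (arrow_elt K a * arrow_elt K b) >]].

Lemma act_nxt x a b : b <> nxt a -> x .* a .* b = 0.
Proof.
move=> ab; rewrite actA act_ideal //; apply: contrapT => nab; apply: ab.
rewrite /nxt; case: pickP => [b' /asboolP nab'|/(_ b)/asboolP//].
exact: (IM a).1.
Qed.

(** The backward half of condition (M), read on the module. *)
Lemma act_prv x y a b d : x .* a .* d <> 0 -> y .* b .* d <> 0 -> a = b.
Proof.
rewrite !actA => h h'.
by apply: (IM d).2 => [/act_ideal|/act_ideal].
Qed.

(** In [r], trivial paths give the scalar, paths beginning with [nxt a] give [s], and all others act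
    as 0 after [a]. Neither [c] nor [s] depends on [x]. *)
Lemma act_arrow_decomp a r : exists (c : K) s,
  forall x, x .* a *> r = c ** (x .* a) + x .* a .* nxt a *> s.
Proof.
elim/path_alg_ind: r => [|c p r [d [s IHr]]].
  by exists 0, 0 => x; rewrite scale0r !act0r addr0.
have [e [t pE]] : exists (c : K) s, forall x,
    x .* a *> path_elt K p = c ** (x .* a) + x .* a .* nxt a *> s.
  elim/path_elt_ind: (path_elt K p) => [v|b q _].
    exists (v == target a)%:R, 0 => x; rewrite act0r addr0 actA arrow_mul_trivial.
    by case: eqP; rewrite ?scale0r ?scale1r ?act0r ?act1.
  have [->|/eqP nb] := eqVneq b (nxt a).
    by exists 0, (path_elt K q) => x; rewrite scale0r act0r add0r -actA.
  by exists 0, 0 => x; rewrite scale0r !act0r -actA act_nxt // act0l addr0.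
exists (c * e + d), (c *: t + s) => x.
rewrite actDr actZr pE IHr actDl -(actZr c _ t) -(actZr c _ (e *: _)) scalerA.
by rewrite addrACA -!actDr -scalerDl.
Qed.

(* [chain x a k] is [x] times the first [k] arrows of the unique path starting
   with [a] along which the product can be nonzero. *)
Fixpoint chain x a k := if k is k'.+1 then chain (x .* a) (nxt a) k' else x.

Lemma chainD x a j k : chain x a (j + k) = chain (chain x a j) (iter j nxt a) k.
Proof. by elim: j x a => //= j IHj x a; rewrite IHj -iterS iterSr. Qed.

Lemma chainS x a k : chain x a k.+1 = chain x a k .* iter k nxt a.
Proof. by rewrite -addn1 chainD. Qed.

Lemma chain_word x a k : chain x a k = x *> word_elt K (traject nxt a k).
Proof. by elim: k x a => [|k IHk] x a /=; rewrite ?act1 // IHk actA. Qed.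

Lemma chain0 a k : chain 0 a k = 0.
Proof. by rewrite chain_word act0l. Qed.

Lemma chain_nil x a k : (n <= k)%N -> chain x a k = 0.
Proof.
move=> /subnKC <-; rewrite chainD (_ : chain x a n = 0) ?chain0 //.
rewrite chain_word act_ideal //; apply: In.
by rewrite -{1}(size_traject nxt a n); exact: word_elt_exp.
Qed.

Lemma chain_eq0 x a j k : (j <= k)%N -> chain x a j = 0 -> chain x a k = 0.
Proof. by move=> /subnKC <- e; rewrite chainD e chain0. Qed.

Lemma chain_decomp x a k r : exists (c : K) s,
  chain x a k.+1 *> r = c ** chain x a k.+1 + chain x a k.+2 *> s.
Proof.
have [c [s cs]] := act_arrow_decomp (iter k nxt a) r.
by exists c, s; rewrite [chain x a k.+2]chainS !chainS cs.
Qed.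

Local Notation tail x a k := (cyclic (chain x a k)).

Lemma tail_le x a j k : (j <= k)%N -> tail x a k `<=` tail x a j.
Proof.
move=> /subnKC <-; rewrite chainD; apply: cyclic_le; first exact: submodule_cyclic.
rewrite (chain_word (chain x a j)); apply: submodule_act; last exact: mem_cyclic.
exact: submodule_cyclic.
Qed.

Lemma tail_act x a k y b : tail x a k.+1 y -> tail x a k.+2 (y .* b).
Proof.
have sT := submodule_cyclic (chain x a k.+2).
move=> [r _ <-]; have [c [s ->]] := chain_decomp x a k r.
rewrite actDl; apply: submoduleD => //; last first.
  by do 2!apply: submodule_act => //; exact: mem_cyclic.
rewrite actZl; apply: submodule_act => //.
have [->|nb] := eqVneq b (iter k.+1 nxt a).
  by rewrite -chainS; exact: mem_cyclic.
by rewrite (chainS x a k) act_nxt; [exact: submodule0|exact/eqP].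
Qed.

(** Multiplying the membership by the next arrow moves it one level down, and beyond level [n] every
    chain vanishes; hence the induction on the distance [d] to [n]. *)
Lemma chain_strict x a k : tail x a k.+2 (chain x a k.+1) -> chain x a k.+1 = 0.
Proof.
have [d] : exists d, (n <= k.+1 + d)%N by exists n; exact: leq_addl.
elim: d k => [|d IHd] k nk h; first by apply: chain_nil; rewrite addn0 in nk.
have e : chain x a k.+2 = 0.
  by apply: IHd; [rewrite addSnnS|rewrite (chainS x a k.+1); exact: tail_act].
by move: h; rewrite e cyclic0.
Qed.

Lemma chain_level x a y : tail x a 1 y -> y <> 0 ->
  exists k, tail x a k.+1 y /\ ~ tail x a k.+2 y.
Proof.
move=> T1 y0; apply: contrapT => h.
have T k : tail x a k.+1 y.
  elim: k => // k IHk; apply: contrapT => nT; apply: h; exists k; split => //.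
by apply: y0; have := T n; rewrite chain_nil // cyclic0.
Qed.

(** [y] is a nonzero multiple [c] of the chain element plus a deeper term. Multiplying by the next
    arrow gives the same situation one level down, with the same [c]; by induction the deeper term
    is in [U] and can be subtracted. *)
Lemma submodule_chain x a k U y : submodule U -> U y ->
  tail x a k.+1 y -> ~ tail x a k.+2 y -> U (chain x a k.+1).
Proof.
move=> sU Uy [r _ yE]; have [c [s cs]] := chain_decomp x a k r; rewrite cs in yE.
move=> nT; have c0 : c != 0.
  apply: contra_notN nT => /eqP c0; rewrite -yE c0 scale0r act0r add0r.
  by exists s.
move: {r cs nT} s yE Uy.
have [d] : exists d, (n <= k.+1 + d)%N by exists n; exact: leq_addl.
elim: d k y => [|d IHd] k y nk s yE Uy.
  by rewrite chain_nil; [exact: submodule0|rewrite addn0 in nk].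
have Uk : U (chain x a k.+2).
  have [t _ tE] : tail x a k.+3 (chain x a k.+2 *> s .* iter k.+1 nxt a).
    by apply: tail_act; exists s.
  apply: (IHd _ (y .* iter k.+1 nxt a) _ t); first by rewrite addSnnS.
    by rewrite tE -yE actDl actZl -chainS.
  exact: submodule_act.
rewrite -(actZK (chain x a k.+1) c0); apply: submodule_act => //.
have -> : c ** chain x a k.+1 = y - chain x a k.+2 *> s by rewrite -yE addrK.
by apply: submoduleB => //; exact: submodule_act.
Qed.

Lemma submodule_tail x a U : submodule U -> U `<=` tail x a 1 -> U <> [set 0] ->
  exists k, U = tail x a k.+1 /\ chain x a k.+1 <> 0.
Proof.
move=> sU UT U0.
have lvl y : U y -> y <> 0 -> exists k, tail x a k.+1 y /\ U (chain x a k.+1).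
  move=> Uy y0; have [k [Tk nTk]] := chain_level (UT _ Uy) y0.
  by exists k; split=> //; exact: (submodule_chain sU Uy).
have [y Uy y0] : exists2 y, U y & y <> 0.
  apply: contrapT => h; apply: U0; apply/seteqP; split=> [y Uy|_ ->].
    by apply: contrapT => y0; apply: h; exists y.
  exact: submodule0.
(* The least such [k] is the top level of [U]. *)
have ex : exists k, `[< U (chain x a k.+1) >].
  by have [k [_ Uk]] := lvl y Uy y0; exists k; exact/asboolP.
case: (ex_minnP ex) => k /asboolP Uk kmin; exists k.
have UE : U = tail x a k.+1.
  apply/seteqP; split; last exact: cyclic_le.
  move=> z Uz; have [->|/eqP z0] := eqVneq z 0.
    by apply: submodule0; exact: submodule_cyclic.
  have [j [Tj Uj]] := lvl z Uz z0.
  by apply: tail_le Tj; rewrite ltnS; apply: kmin; exact/asboolP.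
by split=> // e; apply: U0; rewrite UE e cyclic0.
Qed.

Lemma uniserial_tail x a : uniserial_submodule (tail x a 1).
Proof.
split=> [|V W sV sW VT WT]; first exact: submodule_cyclic.
have [->|V0] := pselect (V = [set 0]).
  by left=> _ ->; exact: submodule0.
have [->|W0] := pselect (W = [set 0]).
  by right=> _ ->; exact: submodule0.
have [[i [-> _]] [j [-> _]]] := (submodule_tail sV VT V0, submodule_tail sW WT W0).
by case: (leqP i j) => ij; [right|left]; apply: tail_le; rewrite ltnS // ltnW.
Qed.

Lemma simple_tail x a k : chain x a k.+1 <> 0 -> chain x a k.+2 = 0 ->
  simple_submodule (tail x a k.+1).
Proof.
move=> nz z; split; first exact: submodule_cyclic.
  by move=> e; apply: nz; have := mem_cyclic (chain x a k.+1); rewrite e.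
move=> V sV VT; have [->|V0] := pselect (V = [set 0]); [by left|right].
have VT1 : V `<=` tail x a 1 by apply: (subset_trans VT); exact: tail_le.
have [j [VE nzj]] := submodule_tail sV VT1 V0.
apply/seteqP; split=> //; rewrite VE; apply: tail_le.
by rewrite ltnNge; apply/negP => kj; apply: nzj; exact: chain_eq0 z.
Qed.

(** The second generator is a nonzero multiple of the first plus a deeper term. Both therefore
    survive multiplication by the arrow [iter p.+1 nxt a], and [act_prv] identifies the arrows
    before it. *)
Lemma tail_eq_arrow x a p y b q : tail x a p.+1 = tail y b q.+1 ->
  chain x a p.+2 <> 0 -> iter p nxt a = iter q nxt b.
Proof.
move=> TE nz; have [r _ vE] : tail x a p.+1 (chain y b q.+1).
  by rewrite TE; exact: mem_cyclic.
have [c [s cs]] := chain_decomp x a p r; rewrite cs in vE.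
have nz1 : chain x a p.+1 <> 0 by move=> e; apply: nz; exact: chain_eq0 e.
have c0 : c != 0.
  apply: contra_notN nz1 => /eqP c0; apply: chain_strict.
  have : tail x a p.+1 (chain x a p.+1) by exact: mem_cyclic.
  rewrite TE; apply: cyclic_le; first exact: submodule_cyclic.
  by rewrite -vE c0 scale0r act0r add0r; exists s.
apply: (@act_prv (chain x a p) (chain y b q) _ _ (iter p.+1 nxt a)).
  by rewrite -!chainS.
rewrite -(chainS y) -vE actDl actZl -chainS => e; apply: nz; apply: chain_strict.
have sT := submodule_cyclic (chain x a p.+3).
rewrite -(actZK (chain x a p.+2) c0); apply: submodule_act => //.
move/eqP: e; rewrite addr_eq0 => /eqP ->; rewrite -sub0r.
by apply: submoduleB; [|exact: submodule0|apply: tail_act; exists s].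
Qed.

(** [nxt] need not be injective because of its default value, but along nonzero chains [act_prv]
    allows walking back. *)
Lemma iter_nxt_cancel x a y b p e :
  chain x a p.+1 <> 0 -> chain y b (p + e).+1 <> 0 ->
  iter p nxt a = iter (p + e) nxt b -> a = iter e nxt b.
Proof.
elim: p => [|p IHp] nx ny E; first exact: E.
apply: IHp.
- by move=> h; apply: nx; exact: chain_eq0 h.
- by move=> h; apply: ny; exact: chain_eq0 h.
- apply: (@act_prv (chain x a p) (chain y b (p + e)) _ _ (iter p.+1 nxt a)).
    by rewrite -!chainS.
  by rewrite E addSn -!chainS.
Qed.

(** * Shortening a chain *)

Lemma chainB x y a k : chain (x - y) a k = chain x a k - chain y a k.
Proof. by rewrite !chain_word actBl. Qed.

Lemma chainZ c x a k : chain (c ** x) a k = c ** chain x a k.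
Proof. by rewrite !chain_word actZl. Qed.

(** The composition length of [x a A], as successive nonzero chain elements generate distinct
    tails. *)
Definition chain_length x a : nat := (\sum_(k < n) (chain x a k.+1 != 0%R))%N.

Lemma chain_length_lt x y a : chain x a 1 <> 0 ->
  (forall k, chain x a k.+2 = 0 -> chain y a k.+1 = 0) ->
  (chain_length y a < chain_length x a)%N.
Proof.
move=> nz h; pose f k : nat := chain x a k.+1 != 0%R.
have -> : chain_length x a = (\sum_(k < n) f k.+1)%N.+1.
  (* The sum may be extended to index [n], where the chain vanishes; splitting off the nonzero first
     term then shifts the others by one. *)
  rewrite /chain_length; have := @big_ord_recr nat 0%N addn n (fun k : 'I_n.+1 => f k).
  rewrite big_ord_recl /= /f (chain_nil _ _ (leqnSn n)) eqxx addn0 => <-.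
  by move/eqP/negPf: nz => ->.
rewrite ltnS; apply: leq_sum => k _; rewrite /f.
by case: (eqVneq (chain x a k.+2) 0%R) => [/h ->|_]; rewrite ?eqxx ?leq_b1.
Qed.

(* If [x a A] and [y b A] share a submodule that is not simple, then subtracting
   from [x] an element [z] with [z a] in [y b A] shortens [x a A]. *)
Lemma chain_reduce x a p y b q : (p <= q)%N -> tail x a p.+1 = tail y b q.+1 ->
  chain x a p.+2 <> 0 ->
  exists z, tail y b 1 (z .* a) /\ (chain_length (x - z) a < chain_length x a)%N.
Proof.
move=> /subnKC <-; set e := (q - p)%N => TE nz.
have nzx k : (k <= p.+2)%N -> chain x a k <> 0.
  by move=> kp h; apply: nz; exact: chain_eq0 h.
have nzy : chain y b (p + e).+1 <> 0.
  move=> h; apply: (nzx p.+1) => //; have := mem_cyclic (chain x a p.+1).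
  by rewrite TE h cyclic0.
(* As [p <= q], the path from [b] runs through [e] arrows and then continues as the path from
   [a]. *)
have aE : a = iter e nxt b.
  apply: iter_nxt_cancel (nzx p.+1 _) nzy _ => //; exact: tail_eq_arrow TE nz.
have [r _ uE] : tail y b (p + e).+1 (chain x a p.+1).
  by rewrite -TE; exact: mem_cyclic.
have [c [s cs]] := chain_decomp y b (p + e) r; rewrite cs in uE.
have vE : chain (chain y b e) a p.+1 = chain y b (p + e).+1.
  by rewrite aE -chainD addnC addSn.
(* This choice cancels the leading term of [chain x a p.+1] written in terms of [y], leaving only a
   deeper term. *)
exists (c ** chain y b e); split.
  rewrite actZl aE -chainS; apply: submodule_act; first exact: submodule_cyclic.
  by apply: (@tail_le _ _ 1 e.+1) => //; exact: mem_cyclic.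
apply: chain_length_lt => [|k]; first exact: nzx.
have [kp|pk] := ltnP k p; first by move=> h; case: (nzx k.+2 (leqW kp) h).
(* From level [p] on, the chain of the difference lies one tail deeper than that of [x]. *)
have : tail x a k.+2 (chain (x - c ** chain y b e) a k.+1).
  move: pk => /subnKC <-; elim: (k - p)%N => [|i IHi]; last first.
    by rewrite addnS [X in _ X]chainS; exact: tail_act.
  rewrite addn0 chainB chainZ vE -uE addrAC subrr add0r.
  apply: submodule_act; first exact: submodule_cyclic.
  by rewrite [X in _ X]chainS; apply: tail_act; rewrite TE; exact: mem_cyclic.
by move=> /[swap] -> ; rewrite cyclic0.
Qed.

(** * Generating families of the radical *)

Definition spans_rad l (m : 'I_l -> M) (a : 'I_l -> arrow Q) :=
  forall U, submodule U -> (forall i, U (m i .* a i)) -> arrow_rad `<=` U.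

(** Induction on the total length; the arrows stay fixed and only the elements [m i] change. *)
Lemma spans_rad_almost_disjoint l (m : 'I_l -> M) (a : 'I_l -> arrow Q) :
  spans_rad m a -> exists2 m', spans_rad m' a &
  forall i j, i != j ->
    tail (m' i) (a i) 1 `&` tail (m' j) (a j) 1 = [set 0] \/
    simple_submodule (tail (m' i) (a i) 1 `&` tail (m' j) (a j) 1).
Proof.
have [N] := ubnP (\sum_i chain_length (m i) (a i))%N.
elim: N m => // N IHN m; rewrite ltnS => mN mP.
have step i j p q : i != j -> (p <= q)%N ->
    tail (m i) (a i) p.+1 = tail (m j) (a j) q.+1 ->
    chain (m i) (a i) p.+2 <> 0 ->
    exists2 m', spans_rad m' a &
      (\sum_i chain_length (m' i) (a i) < \sum_i chain_length (m i) (a i))%N.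
  move=> ij pq TE nz; have [z [Tz lz]] := chain_reduce pq TE nz.
  (* The new family still spans: [m i a] is the sum of [(m i - z) a] and [z a], and the latter lies
     in the unchanged summand of index [j]. *)
  exists (fun k => if k == i then m i - z else m k) => [U sU Um|].
    apply: mP => // k; have := Um k; case: eqP => // -> h.
    rewrite -[m i](subrK z) actDl; apply: submoduleD => //.
    apply: cyclic_le Tz => //; have := Um j; by rewrite eq_sym (negPf ij).
  rewrite (bigD1 i) //= [X in (_ < X)%N](bigD1 i) //= eqxx -addSn leq_add //.
  by apply: leq_sum => k /negPf ->.
apply: contrapT => bad.
have [i [j [ij nU0 nUs]]] : exists i j, [/\ i != j,
    tail (m i) (a i) 1 `&` tail (m j) (a j) 1 <> [set 0] &
    ~ simple_submodule (tail (m i) (a i) 1 `&` tail (m j) (a j) 1)].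
  apply: contrapT => h; apply: bad; exists m => // i j ij.
  apply: contrapT => /not_orP[h1 h2]; apply: h; by exists i, j.
move: nU0 nUs; set U := _ `&` _ => nU0 nUs.
have sU : submodule U by apply: submoduleI; exact: submodule_cyclic.
have [p [pE np]] := submodule_tail sU (@subIsetl _ _ _) nU0.
have [q [qE nq]] := submodule_tail sU (@subIsetr _ _ _) nU0.
(* Were the next chain element zero, the intersection would be simple. *)
have np2 : chain (m i) (a i) p.+2 <> 0.
  by move=> z; apply: nUs; rewrite pE; exact: simple_tail.
have nq2 : chain (m j) (a j) q.+2 <> 0.
  by move=> z; apply: nUs; rewrite qE; exact: simple_tail.
have TE : tail (m i) (a i) p.+1 = tail (m j) (a j) q.+1 by rewrite -pE.
have [m' m'P lt] : exists2 m', spans_rad m' a &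
      (\sum_i chain_length (m' i) (a i) < \sum_i chain_length (m i) (a i))%N.
  case: (leqP p q) => pq; first exact: (step i j p q).
  by apply: (step j i q p); rewrite 1?eq_sym // ltnW.
by apply: bad; apply: IHN m'P; exact: leq_trans lt mN.
Qed.

Lemma spans_rad_generators (t : seq M) : submod_gen t = setT ->
  exists l (m : 'I_l -> M) (f : 'I_l -> arrow Q), spans_rad m f.
Proof.
move=> tT; pose T := ('I_(size t) * arrow Q)%type.
exists #|{: T}|, (fun k => t`_(enum_val k : T).1), (fun k => (enum_val k : T).2).
move=> U sU Um; apply: arrow_rad_le => // x.
(* [Z] is a submodule, so checking it on the generators [t] suffices. *)
pose Z := [set y | forall a, U (y .* a)]; rewrite -/(Z x).
have : submod_gen t x by rewrite tT.
move/(_ Z); apply; split=> [|y yt a]; last first.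
  have sy : (index y t < size t)%N by rewrite index_mem.
  have := Um (enum_rank (Ordinal sy, a)).
  by rewrite enum_rankK /= nth_index.
apply: submodule_arrowP => [a|y z Zy Zz a|c y Zy a|v y Zy a|b y Zy a].
- by rewrite act0l; exact: submodule0.
- by rewrite actDl; exact: submoduleD.
- by rewrite actZl; exact: submodule_act.
- rewrite actA trivial_mul_arrow; case: eqP => // _.
  by rewrite act0r; exact: submodule0.
- exact: submodule_act.
Qed.

Lemma special_multiserial_module : finitely_generated M -> multiserial M.
Proof.
move=> /finitely_generatedP[t tT].
have [l [m0 [a /spans_rad_almost_disjoint[m mP mI]]]] := spans_rad_generators tT.
exists l, (fun i => tail (m i) (a i) 1); split=> // [i|].
  exact: uniserial_tail.
have sT i : submodule (tail (m i) (a i) 1) by exact: submodule_cyclic.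
rewrite mod_radE; apply/seteqP; split.
  apply: mP => [|i]; first exact: submodule_submod_sum.
  by apply: (submod_sum_ge (U := fun i => tail (m i) (a i) 1)) (mem_cyclic _).
apply: submod_sum_le => [|i]; first exact: submodule_arrow_rad.
apply: cyclic_le; [exact: submodule_arrow_rad|exact: mem_arrow_rad].
Qed.

End Nilpotent.
End RightAction.

Theorem theoremA (K : fieldType) (A : falgType K)
  (hA : special_multiserial A)
  (M : lmodType A^c) (hM : finitely_generated M) :
  multiserial M.
Proof.
have [Q [I [[_ [n _ In]] IM [F [G [GF FG]]]]]] := hA.
have [g isog] := equivalence_submodule_iso M GF FG.
apply: (iso_multiserial (submodule_iso_sym isog)).
exact: special_multiserial_module In IM (iso_finitely_generated isog hM).
Qed.
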